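(* Let $\mathbf{A}$ be a real $m\times n$ matrix with $\mathrm{rank}(\mathbf{A})=1$. Then $p_j^{lev}=p_j^{opt}$ for $1\leq j\leq n$. Moreover, if $\mathbf{X}$ is computed by the sampling algorithm (described in the context) with any number of samples $c\geq 1$ and probabilities $p_j=p_j^{opt}$, $1\leq j\leq n$, then $\mathbf{X}=\mathbf{A}\mathbf{A}^T$.
   Context: Let $\mathbf{A}=(A_1\ \cdots\ A_n)$ be a non-zero real $m\times n$ matrix of rank $k$ with thin SVD $\mathbf{A}=\mathbf{U}\mathbf{\Sigma}\mathbf{V}^T$ ($\mathbf{U}$ is $m\times k$ and $\mathbf{V}$ is $n\times k$ with orthonormal columns, $\mathbf{\Sigma}$ is $k\times k$ diagonal with the non-zero singular values). The ``optimal'' probabilities are $p_j^{opt}=\|A_j\|_2^2/\|\mathbf{A}\|_F^2$, and the leverage score probabilities are $p_j^{lev}=\|\mathbf{V}^Te_j\|_2^2/\|\mathbf{V}\|_F^2=\|\mathbf{V}^Te_j\|_2^2/k$, $1\leq j\leq n$, where $e_j$ is the $j$-th column of $\mathbf{I}_n$. Sampling algorithm: given $\mathbf{A}$, a number of samples $c$ (a positive integer) and probabilities $p_j\geq 0$ with $\sum_{j=1}^n p_j=1$, sample indices $t_1,\ldots,t_c$ from $\{1,\ldots,n\}$ independently and with replacement, with $\mathbb{P}[t_j=i]=p_i$; let $\mathbf{S}$ be the $n\times c$ matrix with columns $e_{t_j}/\sqrt{c\,p_{t_j}}$; output $$\mathbf{X}=(\mathbf{A}\mathbf{S})(\mathbf{A}\mathbf{S})^T=\sum_{j=1}^c\frac{1}{c\,p_{t_j}}A_{t_j}A_{t_j}^T.$$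 An index $i$ with $p_i=0$ is never selected, so the possible outcomes are those with $p_{t_j}>0$ for all $j$. *)

(* Defs.v *)
From mathcomp Require Import all_boot all_order all_algebra.

Set Implicit Arguments.
Unset Strict Implicit.
Unset Printing Implicit Defensive.

Import Order.TTheory GRing.Theory Num.Theory.

Local Open Scope ring_scope.

Definition l2norm (R : rcfType) (n : nat) (v : 'cV[R]_n) : R :=
  Num.sqrt (\sum_i v i 0 ^+ 2).

Definition fro_norm (R : rcfType) (m n : nat) (A : 'M[R]_(m, n)) : R :=
  Num.sqrt (\sum_i \sum_j A i j ^+ 2).

(* The singular values are listed by the row s, with Sigma = diag_mx s; no
   ordering of them is required. *)
Definition is_thin_svd (R : rcfType) (m n : nat) (A : 'M[R]_(m, n))
    (U : 'M[R]_(m, \rank A)) (s : 'rV[R]_(\rank A))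
    (V : 'M[R]_(n, \rank A)) : Prop :=
  [/\ U^T *m U = 1%:M,
      V^T *m V = 1%:M,
      forall i, 0 < s 0 i
    & A = U *m diag_mx s *m V^T].
Arguments is_thin_svd {R m n} A U s V.

Definition p_opt (R : rcfType) (m n : nat) (A : 'M[R]_(m, n)) (j : 'I_n) : R :=
  l2norm (col j A) ^+ 2 / fro_norm A ^+ 2.

Definition p_lev (R : rcfType) (n k : nat) (V : 'M[R]_(n, k)) (j : 'I_n) : R :=
  l2norm (V^T *m delta_mx j 0) ^+ 2 / fro_norm V ^+ 2.

Definition sampling_mx (R : rcfType) (n c : nat) (p : 'I_n -> R)
    (t : {ffun 'I_c -> 'I_n}) : 'M[R]_(n, c) :=
  \matrix_(i, j) ((i == t j)%:R / Num.sqrt (c%:R * p (t j))).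

Definition sampling_output (R : rcfType) (m n c : nat) (A : 'M[R]_(m, n))
    (p : 'I_n -> R) (t : {ffun 'I_c -> 'I_n}) : 'M[R]_m :=
  (A *m sampling_mx p t) *m (A *m sampling_mx p t)^T.

Definition possible_outcome (R : rcfType) (n c : nat) (p : 'I_n -> R)
    (t : {ffun 'I_c -> 'I_n}) : Prop :=
  forall j, 0 < p (t j).

(* The joint law of c independent draws with replacement is the product of the
   marginals p. *)
Definition sampling_prob (R : rcfType) (n c : nat) (p : 'I_n -> R)
    (E : pred {ffun 'I_c -> 'I_n}) : R :=
  \sum_(t | E t) \prod_j p (t j).

(* Main.v *)
Require Import Defs.
From mathcomp Require Import all_boot all_order all_algebra.

Set Implicit Arguments.
Unset Strict Implicit.
Unset Printing Implicit Defensive.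

Import Order.TTheory GRing.Theory Num.Theory.

Local Open Scope ring_scope.

(** A matrix of rank one is an outer product [A = x *m y] of a column [x] and a
row [y], so its [j]-th column is [y_j *: x].  Hence [|A_j|^2 = y_j^2 |x|^2] and
[|A|_F^2 = |x|^2 |y|^2]: the factor [|x|^2] cancels and the optimal probability
is [y_j^2 / |y|^2], a function of the row factor alone ([p_opt_outer]).

A thin SVD of [A] is one such factorization, with [y = V^T], and for a single
column [V] the leverage score [V_j^2 / |V|_F^2] is that same expression.

For the sampling algorithm, [A_j A_j^T = y_j^2 x x^T] and
[A A^T = |y|^2 x x^T], so [A_j A_j^T = p_j^opt A A^T] ([col_outer_p_opt]).  Each
of the [c] terms [A_t A_t^T / (c p_t)] of the output with [p_t > 0] is then
exactly [A A^T / c], whichever index [t] was drawn, and their sum is [A A^T].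
The outcomes outside this case contain an index of probability zero, so their
total probability vanishes; the product law has total mass one because the
optimal probabilities sum to one. *)

Lemma sqr_l2norm (R : rcfType) (n : nat) (v : 'cV[R]_n) :
  l2norm v ^+ 2 = \sum_i v i 0 ^+ 2.
Proof. by rewrite sqr_sqrtr // sumr_ge0 // => i _; rewrite sqr_ge0. Qed.

Lemma sqr_fro_norm (R : rcfType) (m n : nat) (A : 'M[R]_(m, n)) :
  fro_norm A ^+ 2 = \sum_i \sum_j A i j ^+ 2.
Proof.
rewrite sqr_sqrtr // sumr_ge0 // => i _; rewrite sumr_ge0 // => j _.
by rewrite sqr_ge0.
Qed.

Lemma sqr_fro_norm_col (R : rcfType) (m n : nat) (A : 'M[R]_(m, n)) :
  fro_norm A ^+ 2 = \sum_j l2norm (col j A) ^+ 2.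
Proof.
rewrite sqr_fro_norm exchange_big; apply: eq_bigr => j _.
by rewrite sqr_l2norm; apply: eq_bigr => i _; rewrite mxE.
Qed.

Lemma sqr_fro_norm_eq0 (R : rcfType) (m n : nat) (A : 'M[R]_(m, n)) :
  (fro_norm A ^+ 2 == 0) = (A == 0).
Proof.
apply/idP/eqP => [|->]; last first.
  by rewrite sqr_fro_norm big1 // => i _; rewrite big1 // => j _; rewrite mxE expr0n.
rewrite sqr_fro_norm psumr_eq0 => [/allP A0|i _]; last first.
  by rewrite sumr_ge0 // => j _; rewrite sqr_ge0.
apply/matrixP => i j; have := A0 i (mem_index_enum i).
rewrite /= psumr_eq0 => [/allP/(_ j (mem_index_enum j))|k _].
  by rewrite /= sqrf_eq0 mxE => /eqP.
by rewrite sqr_ge0.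
Qed.

Lemma mulmx_tr_row (R : rcfType) (n : nat) (y : 'rV[R]_n) :
  y *m y^T = (fro_norm y ^+ 2)%:M.
Proof.
rewrite [LHS]mx11_scalar sqr_fro_norm big_ord1 mxE; congr _%:M.
by apply: eq_bigr => j _; rewrite mxE.
Qed.

Lemma p_opt_ge0 (R : rcfType) (m n : nat) (A : 'M[R]_(m, n)) (j : 'I_n) :
  0 <= p_opt A j.
Proof. by rewrite divr_ge0 // sqr_ge0. Qed.

Lemma sum_p_opt (R : rcfType) (m n : nat) (A : 'M[R]_(m, n)) :
  A != 0 -> \sum_j p_opt A j = 1.
Proof.
by move=> A0; rewrite -mulr_suml -sqr_fro_norm_col divff // sqr_fro_norm_eq0.
Qed.

Lemma col_outer (R : rcfType) (m n : nat) (x : 'cV[R]_m) (y : 'rV[R]_n)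
    (j : 'I_n) :
  col j (x *m y) = y 0 j *: x.
Proof. by apply/matrixP=> i k; rewrite !mxE big_ord1 (ord1 k) mulrC. Qed.

(** The column factor scales every column of [x *m y], and the whole matrix, by
the same norm, so it cancels.  For [y = 0] both sides are [0 / 0 = 0]. *)
Lemma p_opt_outer (R : rcfType) (m n : nat) (x : 'cV[R]_m) (y : 'rV[R]_n)
    (j : 'I_n) :
  x != 0 -> p_opt (x *m y) j = y 0 j ^+ 2 / fro_norm y ^+ 2.
Proof.
rewrite -sqr_fro_norm_eq0 => x0.
have colE k : l2norm (col k (x *m y)) ^+ 2 = y 0 k ^+ 2 * fro_norm x ^+ 2.
  rewrite col_outer sqr_l2norm sqr_fro_norm mulr_sumr.
  by apply: eq_bigr => i _; rewrite big_ord1 mxE exprMn.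
have froE : fro_norm (x *m y) ^+ 2 = fro_norm y ^+ 2 * fro_norm x ^+ 2.
  rewrite sqr_fro_norm_col (sqr_fro_norm y) big_ord1 mulr_suml.
  by apply: eq_bigr => k _; rewrite colE.
by rewrite /p_opt colE froE -mulf_div divff // mulr1.
Qed.

Lemma p_lev_col (R : rcfType) (n : nat) (v : 'cV[R]_n) (j : 'I_n) :
  p_lev v j = v j 0 ^+ 2 / fro_norm v^T ^+ 2.
Proof.
have -> : fro_norm v^T ^+ 2 = fro_norm v ^+ 2.
  rewrite !sqr_fro_norm exchange_big; apply: eq_bigr => i _.
  by apply: eq_bigr => k _; rewrite mxE.
by rewrite /p_lev -colE sqr_l2norm big_ord1 !mxE.
Qed.

(** Stated for a free inner dimension [k], because the dimension [\rank A] of an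
SVD depends on [A] and cannot itself be replaced by [1]. *)
Lemma p_lev_p_opt (R : rcfType) (m n k : nat) (A : 'M[R]_(m, n))
    (B : 'M[R]_(m, k)) (V : 'M[R]_(n, k)) (j : 'I_n) :
  k = 1%N -> A != 0 -> A = B *m V^T -> p_lev V j = p_opt A j.
Proof.
move=> k1 A0 AE; subst k; rewrite AE in A0 *.
have B0 : B != 0 by apply: contra_neq A0 => ->; rewrite mul0mx.
by rewrite p_opt_outer // p_lev_col mxE.
Qed.

(** In rank one all the matrices [A_j A_j^T] are multiples of [A A^T], and taking
traces forces the multiple to be [|A_j|^2 / |A|_F^2]. *)
Lemma col_outer_p_opt (R : rcfType) (m n : nat) (A : 'M[R]_(m, n)) (j : 'I_n) :
  \rank A = 1%N ->
  col j A *m (col j A)^T = p_opt A j *: (A *m A^T).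
Proof.
move=> rA; have A0 : A != 0 by rewrite -mxrank_eq0 rA.
have [x [y AE]] : exists x : 'cV[R]_m, exists y : 'rV[R]_n, A = x *m y.
  have := mulmx_base A; move: (col_base A) (row_base A); rewrite rA => x y <-.
  by exists x, y.
rewrite AE in A0 *.
have x0 : x != 0 by apply: contra_neq A0 => ->; rewrite mul0mx.
have y0 : fro_norm y ^+ 2 != 0.
  by rewrite sqr_fro_norm_eq0; apply: contra_neq A0 => ->; rewrite mulmx0.
have -> : x *m y *m (x *m y)^T = fro_norm y ^+ 2 *: (x *m x^T).
  by rewrite trmx_mul mulmxA -(mulmxA x) mulmx_tr_row mul_mx_scalar -scalemxAl.
rewrite p_opt_outer // scalerA divfK //.
by rewrite col_outer linearZ /= -scalemxAl -scalemxAr scalerA.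
Qed.

(** Column [j] of [A *m sampling_mx p t] is the rescaled column [t j] of [A], and
a Gram product is the sum of the outer products of its columns. *)
Lemma sampling_output_sum (R : rcfType) (m n c : nat) (A : 'M[R]_(m, n))
    (p : 'I_n -> R) (t : {ffun 'I_c -> 'I_n}) :
  (forall j, 0 <= p (t j)) ->
  sampling_output A p t =
    \sum_j (c%:R * p (t j))^-1 *: (col (t j) A *m (col (t j) A)^T).
Proof.
move=> p0.
have ASE i j :
    (A *m sampling_mx p t) i j = A i (t j) / Num.sqrt (c%:R * p (t j)).
  rewrite mxE (bigD1 (t j)) //= big1 => [|k /negPf kt]; last first.
    by rewrite mxE kt mul0r mulr0.
  by rewrite addr0 mxE eqxx mul1r.
apply/matrixP => i l; rewrite summxE [LHS]mxE; apply: eq_bigr => j _.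
rewrite [(_^T) _ _]mxE !ASE !mxE big_ord1 !mxE mulrACA -invfM -expr2 sqr_sqrtr.
  by rewrite mulrC.
by rewrite mulr_ge0 // ler0n.
Qed.

Lemma sampling_output_p_opt (R : rcfType) (m n c : nat) (A : 'M[R]_(m, n))
    (t : {ffun 'I_c -> 'I_n}) :
  \rank A = 1%N -> (0 < c)%N -> possible_outcome (p_opt A) t ->
  sampling_output A (p_opt A) t = A *m A^T.
Proof.
move=> rA c0 pt; rewrite sampling_output_sum => [|j]; last exact: ltW.
rewrite (eq_bigr (fun=> c%:R^-1 *: (A *m A^T))) => [|j _]; last first.
  by rewrite col_outer_p_opt // scalerA invfM divfK // gt_eqF.
rewrite sumr_const card_ord -scaler_nat scalerA divff ?scale1r //.
by rewrite pnatr_eq0 -lt0n.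
Qed.

(** An outcome that is not possible draws an index of probability zero, so its
weight in the product law is zero. *)
Lemma sampling_prob_almost_sure (R : rcfType) (n c : nat) (p : 'I_n -> R)
    (E : pred {ffun 'I_c -> 'I_n}) :
  (forall i, 0 <= p i) -> \sum_i p i = 1 ->
  (forall t, possible_outcome p t -> E t) ->
  sampling_prob p E = 1.
Proof.
move=> p0 p1 pE.
have mass1 : \sum_(t : {ffun 'I_c -> 'I_n}) \prod_j p (t j) = 1.
  by rewrite -(bigA_distr_bigA (fun=> p)) big1 // => j _.
rewrite /sampling_prob -[RHS]mass1 big_mkcond; apply: eq_bigr => t _.
case: ifPn => // nEt; apply/esym/eqP/prodf_eq0.
have [/forallP pt|] := boolP [forall j, 0 < p (t j)].
  by rewrite pE in nEt.
rewrite negb_forall => /existsP[j pj]; exists j => //.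
by rewrite eq_le p0 leNgt pj.
Qed.

Theorem theorem3p1 (R : rcfType) (m n : nat) (A : 'M[R]_(m, n))
    (hA : \rank A = 1%N) :
  (forall (U : 'M[R]_(m, \rank A)) (s : 'rV[R]_(\rank A))
          (V : 'M[R]_(n, \rank A)),
     is_thin_svd A U s V -> forall j : 'I_n, p_lev V j = p_opt A j) /\
  (forall c : nat, (0 < c)%N ->
     (forall t : {ffun 'I_c -> 'I_n},
        possible_outcome (p_opt A) t ->
        sampling_output A (p_opt A) t = A *m A^T) /\
     sampling_prob (p_opt A)
       [pred t : {ffun 'I_c -> 'I_n} |
          sampling_output A (p_opt A) t == A *m A^T] = 1).
Proof.
have A0 : A != 0 by rewrite -mxrank_eq0 hA.
split=> [U s V [_ _ _ AE] j|c c0]; first exact: p_lev_p_opt hA A0 AE.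
have XE t := @sampling_output_p_opt R m n c A t hA c0.
split=> //; apply: sampling_prob_almost_sure (p_opt_ge0 A) (sum_p_opt A0) _.
by move=> t /XE /eqP.
Qed.
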